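(* Let $\{X_n\}_{n\ge 0}$ be the (2-2) random walk with non-homogeneous transition probabilities $\omega$, started from $X_0=0$, and suppose that $\limsup_{n\to\infty}X_n=\infty$ ($P_\omega^0$-a.s.). Let $T_1=\inf\{n\ge 0: X_n>0\}$ and, for $i\le 0$, let $$U_i=(A_{i,1},A_{i,2},A_{i,3},B_{i,1},B_{i,2},B_{i,3},C_{i,1},C_{i,2},C_{i,3})$$ be the vector of numbers of excursions at $i$ of the nine types before $T_1$. Then ($P_\omega^0$-a.s.) $$T_1=1+\sum_{i\le 0}U_i\,(2,2,1,1,1,0,2,2,1)^T .$$
   Context: The (2-2) random walk: for each $i\in\mathbb{Z}$ let $\omega_i=(\omega_i(-2),\omega_i(-1),\omega_i(1),\omega_i(2))$ be a probability vector, and $\omega=\{\omega_i\}_{i\in\mathbb{Z}}$. $\{X_n\}_{n\ge0}$ is the Markov chain on $\mathbb{Z}$ with $P_\omega(X_{n+1}=i+j\mid X_n=i)=\omega_i(j)$ for $j\in\{-2,-1,1,2\}$; $P_\omega^x$ denotes its law when $X_0=x$. Excursions at $i$. An excursion at $i$ is a path segment $X_k,X_{k+1},\dots,X_{k+l},X_{k+l+1}$ with $l\ge 1$, $X_{k+1},\dots,X_{k+l}\le i-1$, $X_{k+l+1}\ge i$, and with first step as follows: type $\mathcal{A}$ at $i$: $X_k=i$, $X_{k+1}=i-1$; type $\mathcal{B}$ at $i$: $X_k=i$, $X_{k+1}=i-2$; type $\mathcal{C}$ at $i$: $X_k=i+1$, $X_{k+1}=i-1$. Each type is divided into three sub-types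 according to the last step $X_{k+l}\to X_{k+l+1}$ of the excursion: sub-type 1 if the last step is $\{i-1\to i\}$, sub-type 2 if it is $\{i-2\to i\}$, sub-type 3 if it is $\{i-1\to i+1\}$. The resulting excursions are denoted $\mathcal{A}_{i,j},\mathcal{B}_{i,j},\mathcal{C}_{i,j}$, $j=1,2,3$. For $i\le 0$ and $j=1,2,3$, $A_{i,j},B_{i,j},C_{i,j}$ are the numbers of $\mathcal{A}_{i,j}$, $\mathcal{B}_{i,j}$, $\mathcal{C}_{i,j}$ excursions, respectively, before $T_1$. Here an excursion whose last step is the step made at time $T_1$ is counted (e.g. $A_{0,3}=1$ may occur when the step hitting $[1,\infty)$ is $\{-1\to 1\}$). *)

(* Defs.v *)
From mathcomp Require Import all_boot all_order all_algebra.
From mathcomp Require Import all_classical all_reals all_analysis.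

Set Implicit Arguments.
Unset Strict Implicit.
Unset Printing Implicit Defensive.

Import Order.TTheory GRing.Theory Num.Theory.
Import numFieldNormedType.Exports.

Local Open Scope classical_set_scope.
Local Open Scope ring_scope.

Definition jumps : seq int := [:: -2; -1; 1; 2].

(* [w i j] is the probability of the jump [j] from the site [i]; the values of
   [w i] outside [jumps] are never used. *)
Definition environment (R : realType) (w : int -> int -> R) : Prop :=
  forall i : int,
    (forall j, j \in jumps -> 0 <= w i j) /\ \sum_(j <- jumps) w i j = 1.

Definition cond_prob d (T : measurableType d) (R : realType)
    (P : probability T R) (A B : set T) : R :=
  fine (P (A `&` B)) / fine (P B).

(* The event X_0 = h_0, ..., X_n = h_n. *)
Definition history (T : Type) (X : nat -> T -> int) (h : nat -> int) (n : nat)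
    : set T :=
  [set t | forall k : nat, (k <= n)%N -> X k t = h k].

(* [X] has law P_w^x.  Conditioning on the whole past expresses the Markov
   property and the transition probabilities together. *)
Definition random_walk22 d (T : measurableType d) (R : realType)
    (P : probability T R) (w : int -> int -> R) (x : int)
    (X : nat -> T -> int) : Prop :=
  [/\ forall (n : nat) (B : set int), measurable (X n @^-1` B),
      P [set t | X 0%N t = x] = 1%E
    & forall (n : nat) (h : nat -> int) (j : int), j \in jumps ->
        P (history X h n) != 0%E ->
        cond_prob P [set t | X n.+1 t = h n + j] (history X h n)
          = w (h n) j].

(* The value is +oo when the path never enters the positive half-line. *)
Definition T1 (R : realType) (x : nat -> int) : \bar R :=
  ereal_inf [set n%:R%:E | n in [set n : nat | 0 < x n]].

Inductive excursion_type := type_A | type_B | type_C.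

Inductive excursion_subtype := sub_1 | sub_2 | sub_3.

Definition first_step (a : excursion_type) (i : int) : int * int :=
  match a with
  | type_A => (i, i - 1)
  | type_B => (i, i - 2)
  | type_C => (i + 1, i - 1)
  end.

Definition last_step (s : excursion_subtype) (i : int) : int * int :=
  match s with
  | sub_1 => (i - 1, i)
  | sub_2 => (i - 2, i)
  | sub_3 => (i - 1, i + 1)
  end.

(* The segment x_k, x_(k+1), ..., x_(k+l), x_(k+l+1) is an excursion at [i]. *)
Definition excursion (x : nat -> int) (i : int) (a : excursion_type)
    (s : excursion_subtype) (k l : nat) : Prop :=
  [/\ (1 <= l)%N,
      forall m : nat, (1 <= m <= l)%N -> x (k + m)%N <= i - 1,
      i <= x (k + l).+1,
      (x k, x k.+1) = first_step a i
    & (x (k + l)%N, x (k + l).+1) = last_step s i].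

(* An excursion ending exactly at time T_1 is counted. *)
Definition nb_excursions (R : realType) (x : nat -> int) (i : int)
    (a : excursion_type) (s : excursion_subtype) : \bar R :=
  counting [set kl : nat * nat | excursion x i a s kl.1 kl.2 /\
                                 ((kl.1 + kl.2).+1%:R%:E <= T1 R x)%E].

Definition U (R : realType) (x : nat -> int) (i : int) : 'rV[\bar R]_9 :=
  \row_(k < 9) nth 0%E
    [:: nb_excursions R x i type_A sub_1;
        nb_excursions R x i type_A sub_2;
        nb_excursions R x i type_A sub_3;
        nb_excursions R x i type_B sub_1;
        nb_excursions R x i type_B sub_2;
        nb_excursions R x i type_B sub_3;
        nb_excursions R x i type_C sub_1;
        nb_excursions R x i type_C sub_2;
        nb_excursions R x i type_C sub_3] k.

Definition weights (R : realType) : 'cV[\bar R]_9 :=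
  \col_(k < 9) (nth 0%N [:: 2; 2; 1; 1; 1; 0; 2; 2; 1]%N k)%:R%:E.

(* [mulmx] is unavailable because \bar R is not a semiring. *)
Definition row_mul_col (R : realType) n (u : 'rV[\bar R]_n)
    (v : 'cV[\bar R]_n) : \bar R :=
  (\sum_(k < n) u ord0 k * v k ord0)%E.

(* Main.v *)
Require Import Defs.
From mathcomp Require Import all_boot all_order all_algebra.
From mathcomp Require Import all_classical all_reals all_analysis.
From mathcomp Require Import zify.

Import Order.TTheory GRing.Theory Num.Theory.
Import numFieldNormedType.Exports.

Local Open Scope classical_set_scope.
Local Open Scope ring_scope.

(* Before T_1 the walk takes T_1 - 1 steps that are downward or end at a
   site <= 0, followed by one step into the positive half-line.  Since it starts
   at 0 and ends above every i <= 0, each downward step from [i, oo) to i - 1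
   is the first step of exactly one excursion at i (of type A or C), and each
   upward step to a site i <= 0 is the last step of exactly one excursion at i
   (of sub-type 1 or 2).  The nine weights count these two kinds of steps. *)

(** * Existence and uniqueness of the excursion with a given first or last step *)

Lemma jump_cases {x : nat -> int} (x_jumps : forall k, x k.+1 - x k \in jumps) k :
  [\/ x k.+1 = x k - 2, x k.+1 = x k - 1, x k.+1 = x k + 1 | x k.+1 = x k + 2].
Proof.
have := x_jumps k; rewrite !inE => /or4P[] /eqP E;
  [apply: Or41|apply: Or42|apply: Or43|apply: Or44]; lia.
Qed.

(** The excursion ends at the first time after [k] when the path is at or above [i], no later than
    [tau]; jumps of size at most 2 leave only the three sub-types. *)
Lemma excursion_of_start {x : nat -> int} {tau i a k} :
  (forall k, x k.+1 - x k \in jumps) -> 0 < x tau -> i <= 0 -> (k < tau)%N ->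
  (x k, x k.+1) = first_step a i ->
  exists s l, excursion x i a s k l /\ (k + l < tau)%N.
Proof.
move=> x_jumps x_gt0 i0 ktau fs.
have xk1 : x k.+1 <= i - 1 by case: a fs => -[] /=; lia.
have ex : exists n, (k < n)%N && (i <= x n).
  by exists tau; rewrite ktau; lia.
case: (ex_minnP ex) => n /andP[kn ixn] nmin.
have ntau : (n <= tau)%N by apply: nmin; rewrite ktau; lia.
(* This makes the length [l = n - k - 1] at least 1. *)
have kn1 : n != k.+1 by apply/eqP => E; move: ixn; rewrite E; lia.
have below m : (k < m < n)%N -> x m <= i - 1.
  move=> /andP[km mn].
  have : ~~ ((k < m)%N && (i <= x m)) by apply/negP => /nmin; lia.
  by rewrite km /=; lia.
have En : n = (k + (n - k).-1).+1 by lia.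
have En1 : (k + (n - k).-1 = n.-1)%N by lia.
have Enp : n = n.-1.+1 by lia.
have b1 := below n.-1 ltac:(lia).
have : exists s, (x n.-1, x n.-1.+1) = last_step s i.
  rewrite Enp in ixn.
  case: (jump_cases x_jumps n.-1) => E; try lia.
    by exists sub_1; rewrite /= E; congr (_, _); lia.
  have [E'|E'] : x n.-1 = i - 1 \/ x n.-1 = i - 2 by lia.
    by exists sub_3; rewrite /= E; congr (_, _); lia.
  by exists sub_2; rewrite /= E; congr (_, _); lia.
case=> s ls; exists s, (n - k).-1; split; last lia.
split=> //; first lia.
- by move=> m mb; apply: below; lia.
- by rewrite -En.
- by rewrite En1.
Qed.

(** Backwards in time: the excursion starts at the last time before [m] when the path is at or above
    [i]; time 0 is a candidate because [i <= 0]. *)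
Lemma excursion_of_end {x : nat -> int} {i s m} :
  x 0%N = 0 -> (forall k, x k.+1 - x k \in jumps) -> i <= 0 ->
  (x m, x m.+1) = last_step s i ->
  exists a k l, excursion x i a s k l /\ (k + l)%N = m.
Proof.
move=> x0 x_jumps i0 ls.
have xm : x m <= i - 1 by case: s ls => -[] /=; lia.
have ixm1 : i <= x m.+1 by case: s ls => -[] /=; lia.
have ex : exists n, (n < m)%N && (i <= x n).
  exists 0%N; rewrite x0 i0 andbT lt0n; apply/eqP => E.
  by move: xm; rewrite E x0; lia.
have bd n : (n < m)%N && (i <= x n) -> (n <= m)%N by lia.
case: (ex_maxnP ex bd) => k /andP[km ixk] kmax.
have below p : (k < p <= m)%N -> x p <= i - 1.
  move=> /andP[kp pm].
  have [->//|pnm] := eqVneq p m.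
  have : ~~ ((p < m)%N && (i <= x p)) by apply/negP => /kmax; lia.
  by rewrite ltn_neqAle pnm pm /=; lia.
have b1 := below k.+1 ltac:(lia).
have Em : (k + (m - k))%N = m by lia.
have : exists a, (x k, x k.+1) = first_step a i.
  case: (jump_cases x_jumps k) => E; try lia.
    have [E'|E'] : x k = i \/ x k = i + 1 by lia.
      by exists type_B; rewrite /= E; congr (_, _); lia.
    by exists type_C; rewrite /= E; congr (_, _); lia.
  by exists type_A; rewrite /= E; congr (_, _); lia.
case=> a fs; exists a, k, (m - k)%N; split=> //.
split=> //; [lia| |by rewrite Em|by rewrite Em].
by move=> p mb; apply: below; lia.
Qed.

(** Both excursions stop at the first return to [[i, oo)], and the three last steps are distinct
    pairs. *)
Lemma excursion_start_inj {x i a a' s s' k l l'} :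
  excursion x i a s k l -> excursion x i a' s' k l' -> l = l' /\ s = s'.
Proof.
move=> [l1 bel up _ ls] [l1' bel' up' _ ls'].
have E : l = l'.
  have [ll|ll|//] := ltngtP l l'.
  - have := bel' l.+1 ltac:(lia); rewrite addnS; lia.
  - have := bel l'.+1 ltac:(lia); rewrite addnS; lia.
split=> //; subst l'; rewrite ls in ls'.
by case: s s' ls' {ls} => -[] //= -[] *; exfalso; lia.
Qed.

(** Both excursions start at the last time at or above [i] before their common end, and the three
    first steps are distinct pairs. *)
Lemma excursion_end_inj {x i a a' s s' k k' l l'} :
  excursion x i a s k l -> excursion x i a' s' k' l' ->
  (k + l = k' + l')%N -> (k, l) = (k', l') /\ a = a'.
Proof.
move=> [l1 bel up fs _] [l1' bel' up' fs' _] E.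
have ixk : i <= x k by case: a fs => -[] /=; lia.
have ixk' : i <= x k' by case: a' fs' => -[] /=; lia.
have kk : k = k'.
  have [ll|ll|//] := ltngtP k k'.
  - have := bel (k' - k)%N ltac:(lia).
    by rewrite (_ : k + (k' - k) = k')%N; lia.
  - have := bel' (k - k')%N ltac:(lia).
    by rewrite (_ : k' + (k - k') = k)%N; lia.
subst k'; split; first by congr (_, _); lia.
rewrite fs in fs'.
by case: a a' fs' {fs} => -[] //= -[] *; exfalso; lia.
Qed.

(** * Cardinals, sums of indicators and the hitting time *)

(** [f] maps [S] bijectively onto a subset of [I_N], whose cardinal is a sum of indicators.
    Excursions are indexed in this way by their start or by their end. *)
Lemma counting_inj_bounded {R : realType} {U : choiceType} (S : set U)
    (f : U -> nat) (N : nat) :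
  (forall p q, S p -> S q -> f p = f q -> p = q) ->
  (forall p, S p -> (f p < N)%N) ->
  counting S =
    ((\sum_(k < N) `[< exists2 p, S p & f p = k >])%N%:R)%:E :> \bar R.
Proof.
move=> finj fN.
have cS : (f @` S #= S)%card.
  by apply: inj_card_eq => p q; rewrite !inE => /finj; exact.
have imN : f @` S `<=` `I_N by move=> _ [p Sp <-]; exact: fN.
have finf : finite_set (f @` S) by apply: sub_finite_set imN (finite_II N).
have finS : finite_set S by rewrite -(eq_finite_set cS).
rewrite /counting asboolT//.
rewrite -(elimT (fcard_eq finf finS) cS) -(finite_card_sum R finf).
rewrite -(setIidr imN) esum_mkcondr esum_fset//; last by move=> k _; case: ifP.
rewrite -fsbig_ord natr_sum -sumEFin; apply: eq_bigr => k _ /=.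
by case: asboolP => Sk; [rewrite mem_set|rewrite memNset].
Qed.

Lemma esum_delta (R : realType) (J : choiceType) (D : set J) (j : J) :
  (\esum_(i in D) ((i == j)%:R%:E : \bar R) = `[< D j >]%:R%:E)%E.
Proof.
rewrite (esumID [set j]); last by move=> i _; rewrite lee_fin ler0n.
rewrite [X in (_ + X)%E]esum1 ?adde0; last by move=> i [_ /eqP/negbTE ->].
case: asboolP => Dj.
  rewrite (_ : D `&` [set j] = [set j]); last by apply: setIidr => _ ->.
  by rewrite esum_set1 eqxx// lee_fin.
rewrite esum1// => i [Di ij]; case: Dj; rewrite -[j]ij; exact: Di.
Qed.

Lemma T1_first {R : realType} {x : nat -> int} {tau : nat} :
  (forall k, (k < tau)%N -> x k <= 0) -> 0 < x tau ->
  T1 R x = tau%:R%:E.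
Proof.
move=> x_le0 x_gt0; apply/eqP; rewrite eq_le; apply/andP; split.
  by apply: ereal_inf_lbound; exists tau.
apply: le_ereal_inf_tmp => _ [n /= xn <-]; rewrite lee_fin ler_nat leqNgt.
by apply/negP => /x_le0; rewrite leNgt xn.
Qed.

Lemma limn_esup_pos (R : realType) (x : nat -> int) :
  limn_esup (fun n => ((x n)%:~R)%:E : \bar R) = +oo%E -> exists n, 0 < x n.
Proof.
move=> lx; apply/not_existsP => x_le0.
suff : (limn_esup (fun n => ((x n)%:~R)%:E : \bar R) <= 0)%E by rewrite lx.
(* The limit superior is an infimum over tail sets, and the whole index set is one of them. *)
apply: ge_ereal_inf; exists (ereal_sup (range (fun n => ((x n)%:~R)%:E : \bar R))).
  by exists setT => //; exact: filterT.
apply: ge_ereal_sup => _ [n _ <-]; rewrite lee_fin lerz0 leNgt.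
by apply/negP => xn; exact: (x_le0 n xn).
Qed.

(** Serves for the three sub-types sharing a first step and for the three types sharing a last
    step. *)
Lemma sum3_asbool {I : Type} {a b c : I} {Q : I -> Prop} :
  (forall i, [\/ i = a, i = b | i = c]) -> a <> b -> a <> c -> b <> c ->
  (forall i j, Q i -> Q j -> i = j) ->
  (`[< Q a >] + `[< Q b >] + `[< Q c >])%N = `[< exists i, Q i >] :> nat.
Proof.
move=> abc ab ac bc Quniq; case: (asboolP (exists i, Q i)) => [[i Qi]|nQ].
  by case: (abc i) => Ei; subst i; rewrite (asboolT Qi) !asboolF// => Q';
    (have := Quniq _ _ Qi Q') => /esym E; auto.
by rewrite !asboolF// => ?; apply: nQ; eexists; eauto.
Qed.

(** * Steps of a path that first becomes positive at time [tau] *)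

Section Counting.
Variables (R : realType) (x : nat -> int) (tau : nat).
Hypothesis x0 : x 0%N = 0.
Hypothesis x_le0 : forall k, (k < tau)%N -> x k <= 0.
Hypothesis x_gt0 : 0 < x tau.
Hypothesis x_jumps : forall k, x k.+1 - x k \in jumps.

(** The last step ends at time [kl.1 + kl.2 + 1], so the strict inequality keeps an excursion ending
    exactly at [tau]. *)
Let early i a s : set (nat * nat) :=
  [set kl | excursion x i a s kl.1 kl.2 /\ (kl.1 + kl.2 < tau)%N].

Let nexc i a s : nat :=
  \sum_(k < tau) `[< exists2 kl, early i a s kl & kl.1 = k >].

Let nb_excursions_early i a s :
  nb_excursions R x i a s = counting (early i a s).
Proof.
rewrite /nb_excursions (T1_first x_le0 x_gt0); congr counting.
by apply/seteqP; split => kl /=; rewrite lee_fin ler_nat.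
Qed.

Let nb_excursionsE i a s : nb_excursions R x i a s = (nexc i a s)%:R%:E.
Proof.
rewrite nb_excursions_early; apply: counting_inj_bounded.
  move=> [k l] [k' l'] [/= e _] [/= e' _] kk; subst k'.
  by have [->] := excursion_start_inj e e'.
by move=> [k l] [/= _]; lia.
Qed.

(** Indexing by ends instead of starts: both sums equal [counting (early i a s)]. *)
Let nexc_end i a s :
  nexc i a s =
    (\sum_(m < tau) `[< exists2 kl, early i a s kl & (kl.1 + kl.2)%N = m >])%N.
Proof.
apply/eqP; rewrite -(eqr_nat R) -eqe -nb_excursionsE nb_excursions_early.
apply/eqP; apply: (counting_inj_bounded (early i a s)
  (fun kl => (kl.1 + kl.2)%N)).
  move=> [k l] [k' l'] [/= e _] [/= e' _] kk.
  by have [->] := excursion_end_inj e e' kk.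
by move=> [k l] [/= _].
Qed.

(** A first step made before [tau] opens exactly one excursion, of one sub-type, and that excursion
    ends by [tau]. *)
Let sum_subtypes i a : i <= 0 ->
  (nexc i a sub_1 + nexc i a sub_2 + nexc i a sub_3 =
   \sum_(k < tau) ((x k, x k.+1) == first_step a i))%N.
Proof.
move=> i0; rewrite -!big_split; apply: eq_bigr => k _ /=.
rewrite (@sum3_asbool _ sub_1 sub_2 sub_3
  (fun s => exists2 kl, early i a s kl & kl.1 = k))//.
- congr (nat_of_bool _); apply/asboolP/eqP => [[s [[k' l] [/= [_ _ _ fs _] _ <-//]]]|fs].
  have [s [l [e kl]]] := excursion_of_start x_jumps x_gt0 i0 (ltn_ord k) fs.
  by exists s, (nat_of_ord k, l).
- by case; [exact: Or31|exact: Or32|exact: Or33].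
- move=> s s' [[k1 l] [/= e _] k1k] [[k2 l'] [/= e' _] k2k].
  by rewrite k1k in e; rewrite k2k in e'; have [] := excursion_start_inj e e'.
Qed.

(** Dual to [sum_subtypes]: a last step closes exactly one excursion, of one type. *)
Let sum_types i s : i <= 0 ->
  (nexc i type_A s + nexc i type_B s + nexc i type_C s =
   \sum_(m < tau) ((x m, x m.+1) == last_step s i))%N.
Proof.
move=> i0; rewrite !nexc_end -!big_split; apply: eq_bigr => m _ /=.
rewrite (@sum3_asbool _ type_A type_B type_C
  (fun a => exists2 kl, early i a s kl & (kl.1 + kl.2)%N = m))//.
- congr (nat_of_bool _); apply/asboolP/eqP => [[a [[k l] [/= [_ _ _ _ ls] _ <-//]]]|ls].
  have [a [k [l [e kl]]]] := excursion_of_end x0 x_jumps i0 ls.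
  by exists a, (k, l) => //; split => //=; rewrite kl.
- by case; [exact: Or31|exact: Or32|exact: Or33].
- move=> a a' [[k l] [/= e _] <-] [[k' l'] [/= e' _] /esym kk].
  by have [] := excursion_end_inj e e' kk.
Qed.

(* The nine weights are the sums u a + v s with u = (1, 0, 1) on the types
   A, B, C and v = (1, 1, 0) on the sub-types 1, 2, 3.  A downward step
   contributes its u at one above its target, an upward step its v at its target. *)
Lemma row_mul_col_steps i : i <= 0 ->
  row_mul_col (U R x i) (weights R) =
    (\sum_(k < tau)
      (i == if x k.+1 < x k then x k.+1 + 1 else x k.+1)%:R%:E)%E.
Proof.
move=> i0.
transitivity (((\sum_(k < tau) ((x k, x k.+1) == first_step type_A i)
  + \sum_(k < tau) ((x k, x k.+1) == first_step type_C i)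
  + \sum_(k < tau) ((x k, x k.+1) == last_step sub_1 i)
  + \sum_(k < tau) ((x k, x k.+1) == last_step sub_2 i))%N%:R)%:E : \bar R).
  rewrite -!sum_subtypes// -!sum_types// /row_mul_col.
  rewrite !big_ord_recl big_ord0 !mxE /= !nb_excursionsE.
  rewrite -!EFinM -!EFinD -!natrM addr0 -!natrD; congr (_%:R%:E).
  lia.
rewrite -!big_split natr_sum -sumEFin; apply: eq_bigr => k _.
congr (_%:R%:E) => /=; rewrite !xpair_eqE.
(* The jumps -1, -2, 1, 2 match only [type_A], [type_C], [sub_1], [sub_2] respectively. *)
case: (jump_cases x_jumps k) => ->; case: ifP => ?; lia.
Qed.

Let tau_gt0 : (0 < tau)%N.
Proof. by rewrite lt0n; apply/eqP => E; move: x_gt0; rewrite E x0. Qed.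

(** After exchanging the sums, each step counts once if it is charged to a site at most 0, which
    holds for all [tau] steps but the last. *)
Lemma T1_excursions :
  T1 R x = (1 + \esum_(i in [set i : int | (i <= 0)%R])
                  row_mul_col (U R x i) (weights R))%E.
Proof.
rewrite (T1_first x_le0 x_gt0) (eq_esum row_mul_col_steps).
rewrite esum_sum; last by move=> i k _ _; rewrite lee_fin ler0n.
under eq_bigr do rewrite esum_delta.
have [n En] : exists n, tau = n.+1 by exists tau.-1; have := tau_gt0; lia.
have -> : (\sum_(k < tau) `[< [set i : int | i <= 0]
    (if x k.+1 < x k then x k.+1 + 1 else x k.+1) >]%:R%:E)%E =
    (\sum_(k < tau) (k.+1 != tau)%:R%:E)%E :> \bar R.
  apply: eq_bigr => k _; congr (_%:R%:E); congr nat_of_bool.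
  rewrite /= asboolb; have xk := x_le0 _ (ltn_ord k).
  (* The last step goes up to a positive site. An earlier one is charged to [x k.+1 <= 0] if upward,
     and to [x k.+1 + 1 <= x k <= 0] if downward. *)
  have [E|ne] := eqVneq k.+1 tau.
    have : 0 < x k.+1 by rewrite E.
    by case: ifP; lia.
  have := x_le0 k.+1 ltac:(by rewrite ltn_neqAle ne; exact: ltn_ord).
  by case: ifP; lia.
rewrite sumEFin -natr_sum -EFinD nat1r; congr (_%:R%:E).
rewrite En big_ord_recr /= eqxx addn0 (eq_bigr (fun=> 1%N)).
  by rewrite sum1_card card_ord.
by move=> k _; have := ltn_ord k; lia.
Qed.

End Counting.

(** * Almost sure properties of the walk *)

Section AlmostSure.
Context {d : measure_display} {T : measurableType d} {R : realType}
  {P : probability T R} {w : int -> int -> R} {x0 : int} {X : nat -> T -> int}.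
Hypothesis env_w : environment w.
Hypothesis walk_X : random_walk22 P w x0 X.

Let X_meas n (B : set int) : measurable [set t | B (X n t)].
Proof. by case: walk_X => + _ _; exact. Qed.

Let history_measurable h n : measurable (history X h n).
Proof.
have -> : history X h n = \bigcap_(k in `I_n.+1) [set t | X k t = h k].
  by apply/seteqP; split.
by apply: bigcap_measurableType => k _; exact: (X_meas k [set h k]).
Qed.

(** The four jumps split the probability of the history in the proportions [w (h n) j], which sum to
    1. *)
Let next_jump h n : P (history X h n `&` [set t | X n.+1 t - h n \in jumps]) =
  P (history X h n).
Proof.
set H := history X h n; have mH : measurable H := history_measurable h n.
have mJ := X_meas n.+1 [set i | i - h n \in jumps].
(* Transition probabilities are given only after histories of positive probability; for a null one
   both sides vanish. *)
have [H0|H0] := eqVneq (P H) 0%E.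
  rewrite H0; apply/eqP; rewrite eq_le measure_ge0 andbT -H0.
  apply: le_measure (@subIsetl _ _ _); apply/mem_set => //.
  exact: measurableI.
pose F j := [set t | X n.+1 t = h n + j] `&` H.
have mF j : measurable (F j).
  exact: measurableI (X_meas n.+1 [set h n + j]) mH.
have PF j : j \in jumps -> P (F j) = (w (h n) j * fine (P H))%:E.
  move=> jj; case: walk_X => _ _ /(_ n h j jj H0) <-.
  rewrite /cond_prob divfK; first by rewrite fineK ?fin_num_measure//; exact: mF.
  by rewrite fine_eq0 ?fin_num_measure.
have -> : H `&` [set t | X n.+1 t - h n \in jumps] =
    \bigcup_(j in [set` jumps]) F j.
  apply/seteqP; split => [t [Ht /= jt]|t [j /= jj [Xt Ht]]].
    by exists (X n.+1 t - h n) => //; split=> //=; rewrite addrC subrK.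
  by split=> //=; rewrite Xt addrC addKr.
rewrite measure_fin_bigcup//; first last.
- move=> j j' _ _ [t [[/= Xj _] [/= Xj' _]]].
  by apply: (addrI (h n)); rewrite -Xj -Xj'.
- exact: finite_seq.
rewrite -fsbig_seq// [LHS](eq_big_seq _ PF) sumEFin -mulr_suml.
by have [_ ->] := env_w (h n); rewrite mul1r fineK// fin_num_measure.
Qed.

(** A forbidden jump at time [n] follows one of countably many integer histories, and after each of
    them it has probability 0. *)
Lemma ae_jumps : {ae P, forall t, forall n, X n.+1 t - X n t \in jumps}.
Proof.
apply: ae_foralln => n.
pose bad (h : nat -> int) :=
  history X h n `\` [set t | X n.+1 t - h n \in jumps].
have bad0 h : P.-negligible (bad h).
  have mJ := X_meas n.+1 [set i | i - h n \in jumps].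
  apply/negligibleP; first exact: measurableD.
  rewrite measureD//; last by rewrite ltey_eq fin_num_measure.
  by rewrite [X in (_ - X)%E](next_jump h n) subee// fin_num_measure.
(* Histories are enumerated through codes of finite sequences; a code of no sequence gives the empty
   one, which only adds a null set to the union. *)
pose decode k : seq int := odflt [::] (unpickle k).
have decodeK s : decode (pickle s) = s by rewrite /decode pickleK.
apply: (@negligibleS _ _ _ _
  (\bigcup_k bad (nth 0 (decode k)))).
  move=> t /= /negP jt; pose s := mkseq (fun k => X k t) n.+1.
  exists (pickle s) => //; rewrite decodeK; split.
    by move=> k kn; rewrite nth_mkseq.
  by rewrite /= nth_mkseq//; exact/negP.
by apply: negligible_bigcup => k; exact: bad0.
Qed.

Lemma ae_start : {ae P, forall t, X 0%N t = x0}.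
Proof.
have m0 := X_meas 0%N [set x0].
apply/negligibleP; first exact: measurableC.
by rewrite [LHS](probability_setC P m0); case: walk_X => _ -> _; rewrite subee.
Qed.

End AlmostSure.

Theorem theorem1p1 (R : realType) (d : measure_display) (T : measurableType d)
    (P : probability T R) (w : int -> int -> R) (X : nat -> T -> int) :
  environment w ->
  random_walk22 P w 0 X ->
  {ae P, forall t, limn_esup (fun n : nat => ((X n t)%:~R)%:E : \bar R) = +oo%E} ->
  {ae P, forall t,
    T1 R (fun n => X n t) =
    (1 + \esum_(i in [set i : int | (i <= 0)%R])
           row_mul_col (U R (fun n => X n t) i) (weights R))%E}.
Proof.
(* Outside a null set the path starts at 0, makes allowed jumps and becomes positive; the rest is
   deterministic. *)
move=> env_w walk_X; apply: filterS3 (ae_jumps env_w walk_X) (ae_start walk_X).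
move=> t jumps_t start_t /limn_esup_pos ex_pos.
case: (ex_minnP ex_pos) => tau x_gt0 tau_min.
apply: (@T1_excursions R _ tau) => // k ktau.
by rewrite leNgt; apply/negP => /tau_min; rewrite leqNgt ktau.
Qed.
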